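(* Let $(X,\lVert\cdot\rVert_X)$ and $(B,\lVert\cdot\rVert_B)$ be reflexive Banach spaces, let $\gamma\colon X\to B$ be a continuous linear map, and set $X_0=\gamma^{-1}(\{0\})$. Let $\rho\colon\mathbb R\to\mathbb R$ be an activation function and $(\Theta_n)_{n\in\mathbb N}$ a sequence of sets of neural network parameters such that every function $x_\theta$ represented by a neural network with activation function $\rho$ and parameters $\theta\in\Theta_n$ is a member of $X$; set $A_n=\{x_\theta\mid\theta\in\Theta_n\}\subset X$. Let $E\colon X\to(-\infty,\infty]$ be a functional, $(\lambda_n)_{n\in\mathbb N}$ a sequence of real numbers with $\lambda_n\to\infty$, and $p\in(1,\infty)$. For $f\in X^*$ define $F_n^f,F^f\colon X\to(-\infty,\infty]$ by $$F_n^f(x)=\begin{cases}E(x)+\lambda_n\lVert\gamma(x)\rVert_B^p-f(x)&\text{for }x\in A_n,\\ \infty&\text{otherwise,}\end{cases}\qquad F^f(x)=\begin{cases}E(x)-f(x)&\text{for }x\in X_0,\\ \infty&\text{otherwise.}\end{cases}$$ Let $\lvert\cdot\rvert$ be an additional norm on $X$ such that the dual space $(X,\lvert\cdot\rvert)^*$ is reflexive ($(X,\lvert\cdot\rvert)$ is not required to be complete). Assume: (i) for every $x\in X_0$ there are $x_n\in A_n$ such that $x_n\to x$ in $(X,\lVert\cdot\rVert_X)$ and $\lambda_n\lVert\gamma(x_n)\rVert_B^p\to0$ as $n\to\infty$; (ii) $E$ is bounded from below, lower semi-continuous with respect to weak convergence in $(X,\lVert\cdot\rVert_X)$, and continuous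 with respect to the norm topology of $(X,\lVert\cdot\rVert_X)$; (iii) for every $f\in X^*$ the sequence $(F_n^f)_{n\in\mathbb N}$ is equi-coercive with respect to $\lVert\cdot\rVert_X$; (iv) the identity $\operatorname{Id}\colon(X,\lVert\cdot\rVert_X)\to(X,\lvert\cdot\rvert)$ is completely continuous, i.e. maps weakly convergent sequences to strongly convergent ones; (v) for every $f\in X^*$ there is a unique minimizer $x^f\in X_0$ of $F^f$, and the solution map $S\colon X_0^*\to X_0$, $f\mapsto x^f$, is demi-continuous, i.e. maps strongly convergent sequences to weakly convergent ones. Let $\delta_n\searrow0$ be a sequence of real numbers and for $f\in X^*$ set $$S_n(f)=\Big\{x\in X\;\Big|\;F_n^f(x)\le\inf_{z\in X}F_n^f(z)+\delta_n\Big\}.$$ Fix $R>0$. Then $$\sup\Big\{\lvert x_n^f-x^f\rvert\;\Big|\;x_n^f\in S_n(f),\ \lVert f\rVert_{(X,\lvert\cdot\rvert)^*}\le R\Big\}\to0\quad\text{for }n\to\infty.$$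
   Context: Neural network functions: given natural numbers $d,m,L,N_0,\dots,N_L$ with $N_0=d$, $N_L=m$, a parameter is a tuple $\theta=((A_1,b_1),\dots,(A_L,b_L))$ with matrices $A_l\in\mathbb R^{N_l\times N_{l-1}}$ and vectors $b_l\in\mathbb R^{N_l}$. Each pair induces the affine map $T_l(y)=A_ly+b_l$, and the function represented by $\theta$ with activation function $\rho\colon\mathbb R\to\mathbb R$ (applied componentwise) is $x\mapsto T_L(\rho(T_{L-1}(\rho(\cdots\rho(T_1(x))))))$. A parameter set $\Theta$ collects all parameters of this form for fixed numbers $d,m,L,N_0,\dots,N_L$. Equi-coercivity: $(F_n)$ is equi-coercive if $\bigcup_{n\in\mathbb N}\{x\in X\mid F_n(x)\le r\}$ is bounded in $X$ for all $r\in\mathbb R$. $X^*$ is the dual of $(X,\lVert\cdot\rVert_X)$ and $X_0^*$ the dual of $(X_0,\lVert\cdot\rVert_X)$. For $f\in X^*$ the minimizer $x^f$ of $F^f$ depends only on the restriction $f|_{X_0}$, which is how $S$ is defined on $X_0^*$. $(X,\lvert\cdot\rvert)^*$ is the space of linear functionals on $X$ continuous with respect to $\lvert\cdot\rvert$, with norm $\lVert f\rVert_{(X,\lvert\cdot\rvert)^*}=\sup_{\lvert x\rvert\le1}f(x)$; by the assumption on the identity map, such functionals belong to $X^*$. *)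

(* Defs.v *)
From HB Require Import structures.
From mathcomp Require Import all_boot all_order all_algebra.
From mathcomp Require Import all_classical all_reals all_analysis.

Set Implicit Arguments.
Unset Strict Implicit.
Unset Printing Implicit Defensive.

Import Order.TTheory GRing.Theory Num.Theory.
Import numFieldNormedType.Exports.

Local Open Scope classical_set_scope.
Local Open Scope ring_scope.

Section dual_space.
Context {R : realType} (V : normedModType R).

Definition dual_pred : {pred V -> R^o} :=
  [pred f | `[< linear f /\ continuous f >]].

Lemma dual_submod_closed : submod_closed dual_pred.
Proof.
split.
  apply/asboolP; split; first by move=> a x y; rewrite /= scaler0 addr0.
  exact: cst_continuous.
move=> a f g /asboolP[lf cf] /asboolP[lg cg]; apply/asboolP; split.
  move=> b x y; rewrite !fctE lf lg !scalerDr -!addrA; congr (_ + _).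
    by rewrite !scalerA mulrC.
  by rewrite addrCA.
move=> x; apply: cvgD; last exact: cg.
by apply: cvgZl_tmp; exact: cf.
Qed.

HB.instance Definition _ :=
  GRing.isSubmodClosed.Build R (V -> R^o) dual_pred dual_submod_closed.

Record dual := Dual { dual_fun :> V -> R^o; dual_funP : dual_fun \in dual_pred }.

HB.instance Definition _ := [isSub for dual_fun].
HB.instance Definition _ := [Choice of dual by <:].
HB.instance Definition _ := [SubChoice_isSubLmodule of dual by <:].

Lemma dual_linear (f : dual) : linear f.
Proof. by case: f => f /= /asboolP[]. Qed.

Lemma dual_continuous (f : dual) : continuous f.
Proof. by case: f => f /= /asboolP[]. Qed.

Definition dual_norm (f : dual) : R := sup [set f x | x in [set x | `|x| <= 1]].

Let lin (f : dual) : {linear V -> R^o} :=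
  HB.pack (f : V -> R^o) (GRing.isLinear.Build _ _ _ _ _ (dual_linear f)).

Lemma dualN (f : dual) x : f (- x) = - f x.
Proof. exact: (linearN (lin f)). Qed.

Lemma dualZ (f : dual) a x : f (a *: x) = a * f x.
Proof. exact: (linearZ_LR (lin f)). Qed.

Lemma dual0 (f : dual) : f 0 = 0.
Proof. exact: (linear0 (lin f)). Qed.

Lemma dual_norm_has_sup (f : dual) :
  has_sup [set f x | x in [set x | `|x| <= 1]].
Proof.
split; first by exists (f 0); exists 0; rewrite //= normr0.
have /linear_bounded_continuous/bounded_funP/(_ 1)[M fM] :
  continuous (lin f) by exact: dual_continuous.
by exists M => _ [x /= x1 <-]; rewrite (le_trans (ler_norm _))// fM.
Qed.

Lemma dual_norm_ub (f : dual) x : `|x| <= 1 -> f x <= dual_norm f.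
Proof.
by move=> x1; apply: (sup_upper_bound (dual_norm_has_sup f)); exists x.
Qed.

Lemma dual_norm_le (f : dual) M :
  (forall x, `|x| <= 1 -> f x <= M) -> dual_norm f <= M.
Proof.
move=> fM; apply: ge_sup; first by case: (dual_norm_has_sup f).
by move=> _ [x /= x1 <-]; exact: fM.
Qed.

Lemma dual_norm_normr (f : dual) x : `|f x| <= dual_norm f * `|x|.
Proof.
wlog fx0 : x / 0 <= f x.
  move=> H; have [|/ltW fx0] := leP 0 (f x); first exact: H.
  by have := H (- x); rewrite dualN !normrN oppr_ge0; exact.
rewrite ger0_norm//; have [->|x0] := eqVneq x 0.
  by rewrite dual0 normr0 mulr0.
rewrite -ler_pdivrMr ?normr_gt0// mulrC -dualZ dual_norm_ub//.
by rewrite normrZ ger0_norm ?invr_ge0// mulVf// normr_eq0.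
Qed.

Lemma dual_norm_ge0 (f : dual) : 0 <= dual_norm f.
Proof. by rewrite -(dual0 f) dual_norm_ub// normr0. Qed.

Lemma ler_dual_normD (f g : dual) :
  dual_norm (f + g) <= dual_norm f + dual_norm g.
Proof. by apply: dual_norm_le => x x1; rewrite lerD// dual_norm_ub. Qed.

Let dual_normZ_le a (f : dual) : dual_norm (a *: f) <= `|a| * dual_norm f.
Proof.
apply: dual_norm_le => x x1; rewrite (le_trans (ler_norm _))//.
rewrite [X in `|X|](_ : _ = a * f x)// normrM ler_wpM2l//.
rewrite (le_trans (dual_norm_normr _ _))//.
by rewrite ler_piMr// dual_norm_ge0.
Qed.

Lemma dual_normZ a (f : dual) : dual_norm (a *: f) = `|a| * dual_norm f.
Proof.
apply/eqP; rewrite eq_le dual_normZ_le/=.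
have [->|a0] := eqVneq a 0; first by rewrite normr0 mul0r dual_norm_ge0.
rewrite -ler_pdivlMl ?normr_gt0// -normfV.
by rewrite -{1}[f](scalerK a0) dual_normZ_le.
Qed.

Lemma dual_norm0_eq0 (f : dual) : dual_norm f = 0 -> f = 0.
Proof.
move=> f0; apply/val_inj/funext => x /=.
by apply/eqP; rewrite -normr_le0 (le_trans (dual_norm_normr f x))// f0 mul0r.
Qed.

HB.instance Definition _ :=
  Lmodule_isNormed.Build R dual ler_dual_normD dual_normZ dual_norm0_eq0.

End dual_space.

Definition reflexive_space (R : realType) (V : normedModType R) : Prop :=
  forall phi : dual (dual V), exists x : V, forall f : dual V, phi f = f x.

Definition weakly_cvg (R : realType) (V : normedModType R)
    (u : nat -> V) (x : V) : Prop :=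
  forall f : dual V, f (u k) @[k --> \oo] --> f x.

Definition weakly_lower_semicontinuous (R : realType) (V : normedModType R)
    (E : V -> \bar R) : Prop :=
  forall (u : nat -> V) (x : V),
    weakly_cvg u x -> (E x <= limn_einf (E \o u))%E.

Definition completely_continuous (R : realType) (V W : normedModType R)
    (T : V -> W) : Prop :=
  forall (u : nat -> V) (x : V), weakly_cvg u x -> T \o u @ \oo --> T x.

Definition demi_continuous (R : realType) (V W : normedModType R)
    (T : V -> W) : Prop :=
  forall (u : nat -> V) (x : V), u @ \oo --> x -> weakly_cvg (T \o u) (T x).

Lemma comp_isometry_continuous (R : realType) (U V W : normedModType R)
    (i : U -> V) (f : V -> W) :
  (forall x y, `|i x - i y| = `|x - y|) -> continuous f -> continuous (f \o i).
Proof.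
move=> iso cf x; apply: continuous_comp; last exact: cf.
apply/cvgrPdist_lt => e e0; near=> y; rewrite iso.
by near: y; exact: cvgr_dist_lt.
Unshelve. all: by end_near. Qed.

Section null_space.
Context {R : realType} {X B : normedModType R} (gamma : {linear X -> B}).

Definition null_pred : {pred X} := [pred x | gamma x == 0].

Lemma null_submod_closed : submod_closed null_pred.
Proof.
split; first by rewrite inE linear0.
by move=> a x y /eqP x0 /eqP y0; rewrite inE linearP x0 y0 scaler0 addr0.
Qed.

HB.instance Definition _ :=
  GRing.isSubmodClosed.Build R X null_pred null_submod_closed.

Record null_space :=
  NullSpace { null_val :> X; null_valP : null_val \in null_pred }.

HB.instance Definition _ := [isSub for null_val].
HB.instance Definition _ := [Choice of null_space by <:].
HB.instance Definition _ := [SubChoice_isSubLmodule of null_space by <:].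

Let null_norm (x : null_space) : R := `|null_val x|.

Let ler_null_normD x y : null_norm (x + y) <= null_norm x + null_norm y.
Proof. exact: ler_normD. Qed.

Let null_normZ a x : null_norm (a *: x) = `|a| * null_norm x.
Proof. exact: normrZ. Qed.

Let null_norm0_eq0 x : null_norm x = 0 -> x = 0.
Proof. by move=> /normr0_eq0 x0; exact: val_inj. Qed.

HB.instance Definition _ :=
  Lmodule_isNormed.Build R null_space ler_null_normD null_normZ null_norm0_eq0.

Lemma null_restrict_subproof (f : dual X) :
  ((fun x : null_space => f x) : null_space -> R^o) \in @dual_pred R null_space.
Proof.
apply/asboolP; split; first by move=> a x y; exact: dual_linear.
by apply: (comp_isometry_continuous _ (@dual_continuous _ _ f)).
Qed.

Definition null_restrict (f : dual X) : dual null_space :=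
  Dual (null_restrict_subproof f).

End null_space.

Record norm_on (R : realType) (V : lmodType R) := NormOn {
  norm_on_fun :> V -> R;
  norm_onD : forall x y, norm_on_fun (x + y) <= norm_on_fun x + norm_on_fun y;
  norm_onZ : forall a x, norm_on_fun (a *: x) = `|a| * norm_on_fun x;
  norm_on0_eq0 : forall x, norm_on_fun x = 0 -> x = 0 }.

(* [renormed N] is the vector space V with N as its only norm, even when V
   already carries one. *)
Definition renormed (R : realType) (V : lmodType R) (N : norm_on V) : Type := V.

Section renormed.
Context {R : realType} {V : lmodType R} (N : norm_on V).

HB.instance Definition _ := GRing.Lmodule.copy (renormed N) V.
HB.instance Definition _ := Lmodule_isNormed.Build R (renormed N)
  (@norm_onD _ _ N) (@norm_onZ _ _ N) (@norm_on0_eq0 _ _ N).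

End renormed.

(* The widths are N_0 = d, [:: N_1; ...; N_(L-1)] = hs and N_L = m, so that
   L = (size hs).+1. *)
Fixpoint nn_param (R : realType) (d : nat) (hs : seq nat) (m : nat) : Type :=
  if hs is h :: hs' then ('M[R]_(h, d) * 'cV[R]_h) * nn_param R h hs' m
  else 'M[R]_(m, d) * 'cV[R]_m.

Fixpoint nn_fun (R : realType) (rho : R -> R) (d : nat) (hs : seq nat) (m : nat)
    : nn_param R d hs m -> 'cV[R]_d -> 'cV[R]_m :=
  match hs return nn_param R d hs m -> 'cV[R]_d -> 'cV[R]_m with
  | [::] => fun theta x => theta.1 *m x + theta.2
  | h :: hs' => fun theta x =>
      nn_fun rho theta.2 (map_mx rho (theta.1.1 *m x + theta.1.2))
  end.

(* How the vector space X is a space of (classes of) functions R^d -> R^m: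
   the functions that are "members of X" form a linear space [fdom], and
   [fclass u] is the element of X given by u.  If X literally consists of
   functions, [fclass] is injective on [fdom]; in general it may identify
   functions, for instance those that agree almost everywhere on a domain. *)
Record function_space (R : realType) (d m : nat) (X : lmodType R) :=
  FunctionSpace {
    fdom : set ('cV[R]_d -> 'cV[R]_m);
    fclass : ('cV[R]_d -> 'cV[R]_m) -> X;
    fdom0 : fdom (fun=> 0);
    fdomP : forall a u v,
      fdom u -> fdom v -> fdom (fun x => a *: u x + v x);
    fclassP : forall a u v, fdom u -> fdom v ->
      fclass (fun x => a *: u x + v x) = a *: fclass u + fclass v;
    fclass_surj : forall x, exists2 u, fdom u & fclass u = x }.

Section functionals.
Context {R : realType} {X B : normedModType R}.
Variables (gamma : X -> B) (E : X -> \bar R).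

Definition penalized_energy (p lambda : R) (A : set X) (f : dual X) (x : X)
    : \bar R :=
  if x \in A then (E x + (lambda * `|gamma x| `^ p)%:E - (f x)%:E)%E else +oo%E.

Definition limit_energy (f : dual X) (x : X) : \bar R :=
  if gamma x == 0 then (E x - (f x)%:E)%E else +oo%E.

End functionals.

Definition minimizer (R : realType) (T : Type) (F : T -> \bar R) (x : T) : Prop :=
  forall z, (F x <= F z)%E.

Definition quasi_minimizers (R : realType) (T : Type) (F : T -> \bar R)
    (delta : R) : set T :=
  [set x | (F x <= ereal_inf (range F) + delta%:E)%E].

Definition equi_coercive (R : realType) (X : normedModType R)
    (F : nat -> X -> \bar R) : Prop :=
  forall r : R, bounded_set (\bigcup_n [set x | (F n x <= r%:E)%E]).

(* The supremum in [0, +oo], where that of the empty set is 0.  For a nonempty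
   set of nonnegative values it is the supremum in \bar R. *)
Definition sup_ge0 (R : realType) (A : set (\bar R)) : \bar R :=
  ereal_sup (0%E |` A).

(* Main.v *)
Require Import Defs.
From HB Require Import structures.
From mathcomp Require Import all_boot all_order all_algebra.
From mathcomp Require Import all_classical all_reals all_analysis.
From mathcomp Require Import lra.

Set Implicit Arguments.
Unset Strict Implicit.
Unset Printing Implicit Defensive.

Import Order.TTheory GRing.Theory Num.Theory.
Import numFieldNormedType.Exports.

Local Open Scope classical_set_scope.
Local Open Scope ring_scope.

(** Suppose the conclusion fails.  Then there are [e > 0], indices tending to
    infinity, functionals [f_k] that extend to [g_k] in the dual of [(X, N)]
    with [`|g_k| <= rad], and quasi-minimizers [x_k] of the penalized energies
    for [f_k] such that [N (x_k - xmin f_k) > e].  The contradiction comes from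
    two compactness arguments.

    The loads are compact.  The dual of [(X, N)] is reflexive, so a subsequence
    of [g_k] converges weakly to some [g].  The adjoint of a completely
    continuous map on a reflexive space maps weakly convergent sequences to
    strongly convergent ones ([weakly_cvg_restrict]), so [f_k] converges in norm
    in the dual of [X] to the restriction [f] of [g].

    The quasi-minimizers are compact ([quasi_minimizers_subseq]).  Recovery
    sequences and the continuity of [E] show that the energies of [x_k] are
    asymptotically at most [E z - f z] for each [z] in the kernel of [gamma]
    ([quasi_minimizers_asymptotic_le]).  Coercivity is assumed for each fixed
    load only, whereas the load here depends on [k]; the uniform boundedness
    principle, applied to the [x_k] divided by [1 + `|f_k - f| * `|x_k|],
    bridges the gap and bounds [x_k] ([energy_sublevel_bounded]).  Weak limits of
    subsequences lie in the kernel of [gamma], because the penalty blows up, and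
    minimize the limit energy by weak lower semicontinuity
    ([weak_limit_minimizer]); by uniqueness they equal [xmin f].  Demi-continuity
    of [S] gives that [xmin f_k] also converges weakly to [xmin f].  Complete
    continuity of the identity turns both weak convergences into convergence for
    [N], so [N (x_k - xmin f_k)] tends to 0 along a subsequence.

    Both arguments rest on the theorem that bounded sequences in a reflexive
    space have weakly convergent subsequences ([weakly_cvg_subseq]).  It is
    proved here from the Hahn-Banach theorem and ultrafilters. *)

(** * The Hahn-Banach theorem *)

Section hahn_banach.
Context {R : realType} {V : lmodType R}.
Implicit Types (p q : V -> R) (x y : V).

Definition sublinear q :=
  (forall x y, q (x + y) <= q x + q y) /\
  (forall a x, 0 <= a -> q (a *: x) <= a * q x).

Lemma sublinearZ q a x : sublinear q -> 0 <= a -> q (a *: x) = a * q x.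
Proof.
move=> [qD qZ]; rewrite le_eqVlt => /predU1P[<-|a0].
  rewrite scale0r mul0r; apply/eqP; rewrite eq_le; apply/andP; split.
    by have := qZ 0 0 (lexx _); rewrite scale0r mul0r.
  by have := qD 0 0; rewrite addr0; lra.
apply/eqP; rewrite eq_le (qZ _ _ (ltW a0))/= -ler_pdivlMl//.
by rewrite -{1}(scalerK (lt0r_neq0 a0) x) qZ// invr_ge0 ltW.
Qed.

Lemma sublinear0 q : sublinear q -> q 0 = 0.
Proof. by move=> sq; rewrite -(scale0r 0) sublinearZ// mul0r. Qed.

Lemma sublinearN_ge q x : sublinear q -> - q (- x) <= q x.
Proof.
move=> sq; have := sq.1 x (- x); rewrite subrr sublinear0//; lra.
Qed.

(** The largest sublinear minorant of [q] that is at most [- q y] at [- y]; it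
    makes [q] additive in the direction [y]. *)
Definition tilt q y x := inf [set q (x + t *: y) - t * q y | t in [set t | 0 <= t]].

Lemma tilt_has_inf q y x : sublinear q ->
  has_inf [set q (x + t *: y) - t * q y | t in [set t | 0 <= t]].
Proof.
move=> sq; split; first by exists (q (x + 0 *: y) - 0 * q y), 0 => /=.
exists (- q (- x)) => _ [t /= t0 <-].
have := sq.1 (x + t *: y) (- x); rewrite addrAC subrr add0r sublinearZ//; lra.
Qed.

Lemma tilt_le q y x t : sublinear q -> 0 <= t ->
  tilt q y x <= q (x + t *: y) - t * q y.
Proof.
by move=> sq t0; apply: (ge_inf (tilt_has_inf y x sq).2); exists t.
Qed.

Lemma le_tilt q y x M : sublinear q ->
  (forall t, 0 <= t -> M <= q (x + t *: y) - t * q y) -> M <= tilt q y x.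
Proof.
move=> sq H; apply: lb_le_inf; first exact: (tilt_has_inf y x sq).1.
by move=> _ [t /= t0 <-]; exact: H.
Qed.

Lemma sublinear_tilt q y : sublinear q -> sublinear (tilt q y).
Proof.
move=> sq; split=> [x z|a x a0].
  rewrite -lerBlDr; apply: le_tilt => // t t0.
  rewrite lerBlDr -lerBlDl; apply: le_tilt => // s s0.
  rewrite lerBlDl; apply: le_trans (tilt_le _ _ sq (addr_ge0 t0 s0)) _.
  have := sq.1 (x + t *: y) (z + s *: y).
  by rewrite addrACA -scalerDl; lra.
move: a0; rewrite le_eqVlt => /predU1P[<-|a0].
  rewrite scale0r mul0r; have := @tilt_le q y 0 0 sq (lexx _).
  by rewrite scale0r mul0r addr0 subr0 (sublinear0 sq).
rewrite -ler_pdivrMl//; apply: le_tilt => // t t0.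
rewrite ler_pdivrMl//.
apply: (le_trans (tilt_le y (a *: x) sq (mulr_ge0 (ltW a0) t0))).
rewrite -scalerA -scalerDr sublinearZ//; last exact: ltW.
by rewrite mulrBr mulrA.
Qed.

Lemma tilt_le_id q y x : sublinear q -> tilt q y x <= q x.
Proof.
by move=> sq; have := @tilt_le q y x 0 sq (lexx _); rewrite scale0r mul0r addr0 subr0.
Qed.

(** A minimal [q] coincides with [tilt q y] for every [y], and
    [tilt q y x <= q (x + y) - q y] then supplies the missing superadditivity. *)
Lemma minimal_sublinear_linear q : sublinear q ->
  (forall q', sublinear q' -> (forall x, q' x <= q x) -> q' = q) ->
  linear (q : V -> R^o).
Proof.
move=> sq qmin.
have qD x y : q (x + y) = q x + q y.
  apply/eqP; rewrite eq_le sq.1/=.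
  have <- := qmin _ (sublinear_tilt y sq) (fun x => tilt_le_id y x sq).
  have /= := @tilt_le q y x 1 sq ler01; rewrite scale1r mul1r.
  by rewrite (qmin _ (sublinear_tilt y sq) (fun x => tilt_le_id y x sq)); lra.
have qN x : q (- x) = - q x.
  by have := qD x (- x); rewrite subrr sublinear0//; lra.
move=> a x y; rewrite qD; congr (_ + _).
have [a0|a0] := leP 0 a; first exact: sublinearZ.
rewrite -{1}[a]opprK scaleNr qN sublinearZ ?oppr_ge0 ?ltW//.
by rewrite mulNr opprK.
Qed.

(** Zorn's lemma: along a chain the pointwise infimum is finite, since every
    member [q] satisfies [- p (- x) <= q x], and it is again sublinear, because
    two members of a chain can be replaced by the smaller one. *)
Lemma minimal_sublinear_exists p : sublinear p ->
  exists q, [/\ sublinear q, forall x, q x <= p x &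
    forall q', sublinear q' -> (forall x, q' x <= q x) -> q' = q].
Proof.
move=> sp.
pose P q := `[< sublinear q /\ forall x, q x <= p x >].
pose T := {q : V -> R | P q}.
pose le (s t : T) := `[< forall x, sval t x <= sval s x >].
have [||||[q Pq] qmin] := @Zorn T le.
- by move=> t; apply/asboolP.
- move=> r s t /asboolP rs /asboolP st; apply/asboolP => x.
  exact: le_trans (st x) (rs x).
- move=> [s Ps] [t Pt] /asboolP/= st /asboolP/= ts; apply: eq_exist.
  by apply/funext => x; apply/eqP; rewrite eq_le st ts.
- move=> A Atot; have [[a0 Aa0]|/set0P/negP/negPn/eqP->] := pselect (A !=set0);
    last by exists (exist _ p (asboolT (conj sp (fun x => lexx _)))).
  have sA (a : T) : sublinear (sval a) := (asboolW (svalP a)).1.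
  have pA (a : T) x : sval a x <= p x := (asboolW (svalP a)).2 x.
  (* The pointwise infimum is the upper bound of the chain for [le], which reverses
     the pointwise order. *)
  pose m x := inf [set sval a x | a in A].
  have mhas x : has_inf [set sval a x | a in A].
    split; first by exists (sval a0 x), a0.
    exists (- p (- x)) => _ [a _ <-].
    by apply: le_trans (sublinearN_ge _ (sA a)); rewrite lerN2.
  have m_le x a : A a -> m x <= sval a x.
    by move=> Aa; apply: (ge_inf (mhas x).2); exists a.
  have le_m x M : (forall a, A a -> M <= sval a x) -> M <= m x.
    move=> H; apply: lb_le_inf; first exact: (mhas x).1.
    by move=> _ [a Aa <-]; exact: H.
  have Pm : P m.
    apply/asboolP; split; last by move=> x; exact: le_trans (m_le x _ Aa0) _.
    split=> [x y|a x a0'].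
      rewrite -lerBlDr; apply: (le_m) => a Aa.
      rewrite lerBlDr -lerBlDl; apply: (le_m) => b Ab; rewrite lerBlDl.
      have [/asboolP ab|/asboolP ba] := Atot _ _ Aa Ab.
        apply: le_trans (m_le _ _ Ab) _; apply: le_trans ((sA b).1 x y) _.
        by have := ab x; lra.
      apply: le_trans (m_le _ _ Aa) _; apply: le_trans ((sA a).1 x y) _.
      by have := ba y; lra.
    move: a0'; rewrite le_eqVlt => /predU1P[<-|a_gt0].
      rewrite scale0r mul0r; apply: le_trans (m_le _ _ Aa0) _.
      by rewrite (sublinear0 (sA a0)).
    rewrite -ler_pdivrMl//; apply: (le_m) => b Ab; rewrite ler_pdivrMl//.
    by rewrite -(sublinearZ _ (sA b) (ltW a_gt0)) m_le.
  exists (exist _ m Pm) => s As; apply/asboolP => x /=; exact: m_le.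
have [sq qp] := asboolW Pq.
exists q; split => // q' sq' q'q.
have Pq' : P q' by apply/asboolP; split => // x; exact: le_trans (q'q x) (qp x).
exact: (congr1 sval (qmin (exist _ q' Pq') (asboolT q'q))).
Qed.

(** Linear functionals are the minimal sublinear ones, so it suffices to take one
    below [tilt p x0]: it is at most [- p x0] at [- x0], hence at least [p x0] at
    [x0]. *)
Theorem hahn_banach p x0 : sublinear p ->
  exists f : V -> R,
    [/\ linear (f : V -> R^o), forall x, f x <= p x & f x0 = p x0].
Proof.
move=> sp.
have [f [sf ft fmin]] := minimal_sublinear_exists (sublinear_tilt x0 sp).
have fp x : f x <= p x := le_trans (ft x) (tilt_le_id x0 x sp).
exists f; split => //; first exact: minimal_sublinear_linear.
apply/eqP; rewrite eq_le fp/=.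
have := le_trans (ft (- x0)) (tilt_le x0 (- x0) sp ler01).
rewrite scale1r mul1r addNr sublinear0// sub0r => h.
by have := sublinearN_ge x0 sf; lra.
Qed.

End hahn_banach.

(** * Dual spaces and the uniform boundedness principle *)

Section dual_basics.
Context {R : realType} {V : normedModType R}.
Implicit Types (f g : dual V) (x y : V).

Lemma dualD f x y : f (x + y) = f x + f y.
Proof. by have := dual_linear f 1 x y; rewrite !scale1r. Qed.

Lemma dualB f x y : f (x - y) = f x - f y.
Proof. by rewrite dualD dualN. Qed.

Lemma dual_addE f g x : (f + g) x = f x + g x :> R.
Proof. by []. Qed.

Lemma dual_subE f g x : (f - g) x = f x - g x :> R.
Proof. by []. Qed.

Lemma dual_le f x : `|f x| <= `|f| * `|x|.
Proof. exact: dual_norm_normr. Qed.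

Lemma dual_norm_le_bound f M : 0 <= M -> (forall x, `|f x| <= M * `|x|) ->
  `|f| <= M.
Proof.
move=> M0 fM; apply: dual_norm_le => x x1.
by rewrite (le_trans (ler_norm _))// (le_trans (fM x))// ler_piMr.
Qed.

Lemma dual_of_bounded (h : V -> R) M : linear (h : V -> R^o) ->
  (forall x, `|h x| <= M * `|x|) -> exists f, forall x, f x = h x.
Proof.
move=> lh hM.
pose L : {linear V -> R^o} := HB.pack (h : V -> R^o)
  (GRing.isLinear.Build _ _ _ _ _ lh).
have ch : continuous (h : V -> R^o).
  apply/(linear_bounded_continuous L)/bounded_funP => r.
  exists (`|M| * r) => x xr; apply: le_trans (hM x) _.
  by apply: le_trans (ler_wpM2r _ (ler_norm M)) _; rewrite ?ler_wpM2l.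
by exists (Dual (asboolT (conj lh ch))).
Qed.

Lemma dual_of_dominated (h : V -> R) : linear (h : V -> R^o) ->
  (forall x, h x <= `|x|) -> exists2 f : dual V, `|f| <= 1 & forall x, f x = h x.
Proof.
move=> lh hle.
pose L : {linear V -> R^o} := HB.pack (h : V -> R^o)
  (GRing.isLinear.Build _ _ _ _ _ lh).
have hN y : `|h y| <= 1 * `|y|.
  rewrite mul1r ler_norml hle andbT.
  have hNy : h (- y) = - h y := linearN L y.
  by rewrite lerNl -hNy (le_trans (hle _))// normrN.
have [f fh] := dual_of_bounded lh hN; exists f => //.
by apply: dual_norm_le_bound => // y; rewrite fh.
Qed.

Lemma sublinear_norm : sublinear (fun x : V => `|x|).
Proof.
by split=> [x y|a x a0]; [exact: ler_normD|rewrite normrZ ger0_norm].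
Qed.

Lemma norming_functional x : exists2 f : dual V, `|f| <= 1 & f x = `|x|.
Proof.
have [h [lh hle hx]] := hahn_banach x sublinear_norm.
by have [f f1 fh] := dual_of_dominated lh hle; exists f; rewrite ?fh.
Qed.

End dual_basics.

Lemma dual_eval (R : realType) (V : normedModType R) (x : V) :
  exists2 phi : dual (dual V), `|phi| <= `|x| & forall f, phi f = f x.
Proof.
have le (f : dual V) : `|f x| <= `|x| * `|f| by rewrite mulrC dual_le.
have lin : linear ((fun f : dual V => f x) : dual V -> R^o) by [].
have [phi phiE] := dual_of_bounded lin le.
exists phi => //; apply: dual_norm_le_bound => // f; rewrite phiE; exact: le.
Qed.

Section dual_complete.
Context {R : realType} {V : normedModType R}.

(** A Cauchy filter of functionals converges pointwise, and the pointwise limit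
    [h] stays within [e * `|x|] of some functional [f0] near the filter; hence [h]
    is bounded and is also the limit in norm. *)
Lemma dual_cauchy_cvg (F : set_system (dual V)) :
  ProperFilter F -> cauchy F -> cvg F.
Proof.
move=> FF /cauchyP Fc.
have near_ctr e : 0 < e -> exists f0 : dual V, \forall f \near F, `|f0 - f| < e.
  by move=> /Fc[f0]; rewrite -ball_normE => ?; exists f0.
have /choice[h hE] x : exists l : R, (f : dual V) x @[f --> F] --> (l : R^o).
  apply/cvg_ex; apply: (@cauchy_cvg R^o); apply/cauchyP => e e0.
  have x1 : 0 < `|x| + 1 by rewrite ltr_wpDl.
  have [f0 f0F] := near_ctr _ (divr_gt0 e0 x1).
  exists (f0 x); rewrite -ball_normE.
  change (\forall f \near F, `|f0 x - (f : dual V) x| < e); near=> f.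
  apply: le_lt_trans (dual_le (f0 - f) x) _.
  apply: (@le_lt_trans _ _ (`|f0 - f| * (`|x| + 1))).
    by rewrite ler_wpM2l// lerDl.
  rewrite -ltr_pdivlMr//; near: f; exact: f0F.
have lin : linear (h : V -> R^o).
  move=> a x y; apply: (norm_cvg_unique (hE (a *: x + y))).
  rewrite /= (_ : (fun f : dual V => f (a *: x + y)) =
      (fun f : dual V => a *: (f x : R^o) + (f y : R^o))); last first.
    by apply/funext => f; exact: dual_linear.
  by apply: cvgD; [apply: cvgZl_tmp|]; exact: hE.
have near_le e : 0 < e -> exists2 f0 : dual V,
    \forall f \near F, `|f0 - f| < e & forall x, `|h x - f0 x| <= e * `|x|.
  move=> e0; have [f0 f0F] := near_ctr _ e0; exists f0 => // x.
  rewrite distrC; apply: (cvgr_to_le (f := fun f : dual V => `|f0 x - f x|) (F := F)).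
    by apply: cvg_norm; apply: cvgB; [exact: cvg_cst|exact: hE].
  near=> f; apply: le_trans (dual_le (f0 - f) x) _.
  by rewrite ler_wpM2r// ltW//; near: f; exact: f0F.
have [f1 _ hf1] := near_le 1 ltr01.
have [f fh] : exists f : dual V, forall x, f x = h x.
  apply: (dual_of_bounded (M := `|f1| + 1)) lin _ => x.
  rewrite -[h x](subrK (f1 x)) (le_trans (ler_normD _ _))// addrC mulrDl.
  by rewrite lerD ?dual_le.
apply/cvg_ex; exists f; apply/cvgrPdist_le => e e0.
have [f0 f0F hf0] := near_le _ (divr_gt0 e0 (ltr0n _ 2)).
near=> g; rewrite -(subrK f0 f) -addrA (le_trans (ler_normD _ _))//.
rewrite [leRHS](splitr e) lerD//.
  apply: dual_norm_le_bound => [|x]; first by rewrite divr_ge0 ?ltW.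
  by rewrite dual_subE fh.
by rewrite ltW//; near: g; exact: f0F.
Unshelve. all: by end_near. Qed.

HB.instance Definition _ := Uniform_isComplete.Build (dual V) dual_cauchy_cvg.

(** The Banach-Steinhaus theorem on the complete space [dual V], for the
    evaluations at the points [u t]; norming functionals turn the bound on
    evaluations into a bound on norms. *)
Lemma weakly_bounded_bounded (T : Type) (u : T -> V) :
  (forall f : dual V, exists M, forall t, `|f (u t)| <= M) ->
  exists M, forall t, `|u t| <= M.
Proof.
move=> uw.
pose ev t : dual V -> R^o := fun f => f (u t).
have [_ [t _ <-]|f|M MP] := @Banach_Steinhauss R (dual V) R^o (range ev) _ _ 1.
- split => // r; exists (r * `|u t|) => f fr.
  by apply: le_trans (dual_le f (u t)) _; rewrite ler_wpM2r.
- by have [M fM] := uw f; exists M => _ [t _ <-]; exact: fM.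
exists M => t; have [f f1 <-] := norming_functional (u t).
by apply: le_trans (ler_norm _) _; apply: (MP (ev t)) => //; exists t.
Qed.

End dual_complete.

(** * Sequential weak compactness in reflexive spaces *)

Section annihilator.
Context {R : realType} {V : normedModType R} (D : set V).
Hypotheses (D0 : D 0) (DD : forall x y, D x -> D y -> D (x + y))
  (DZ : forall a x, D x -> D (a *: x)).

(** The distance to [D] is sublinear and vanishes on [D].  A linear functional
    below it therefore annihilates [D], and the Hahn-Banach theorem gives one that
    equals the distance at a prescribed point. *)
Let dist (x : V) := inf [set `|x - d| | d in D].

Let dist_lb x : has_lbound [set `|x - d| | d in D].
Proof. by exists 0 => _ [d _ <-]. Qed.

Let dist_le x d : D d -> dist x <= `|x - d|.
Proof. by move=> Dd; apply: (ge_inf (dist_lb x)); exists d. Qed.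

Let le_dist x M : (forall d, D d -> M <= `|x - d|) -> M <= dist x.
Proof.
move=> H; apply: lb_le_inf; first by exists `|x - 0|, 0.
by move=> _ [d Dd <-]; exact: H.
Qed.

Let sublinear_dist : sublinear dist.
Proof.
split=> [x y|a x].
  rewrite -lerBlDr; apply: le_dist => d Dd.
  rewrite lerBlDr -lerBlDl; apply: le_dist => d' Dd'; rewrite lerBlDl.
  by rewrite (le_trans (dist_le _ (DD Dd Dd')))// opprD addrACA ler_normD.
rewrite le_eqVlt => /predU1P[<-|a0].
  by rewrite scale0r mul0r (le_trans (dist_le _ D0))// subrr normr0.
rewrite -ler_pdivrMl//; apply: le_dist => d Dd; rewrite ler_pdivrMl//.
rewrite (le_trans (dist_le _ (DZ a Dd)))// -scalerBr normrZ.
by rewrite ger0_norm// ltW.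
Qed.

Lemma annihilator_closure z :
  (forall f : dual V, (forall d, D d -> f d = 0) -> f z = 0) ->
  forall e, 0 < e -> exists2 d, D d & `|z - d| < e.
Proof.
move=> ann e e0.
have [h [lh hle hz]] := hahn_banach z sublinear_dist.
have h_norm y : h y <= `|y|.
  by apply: le_trans (hle y) _; rewrite -{2}(subr0 y) dist_le.
have [f _ fh] := dual_of_dominated lh h_norm.
have f_le0 d : D d -> f d <= 0.
  move=> Dd; rewrite fh (le_trans (hle d))// (le_trans (dist_le _ Dd))//.
  by rewrite subrr normr0.
have fD d : D d -> f d = 0.
  move=> Dd; apply/eqP; rewrite eq_le f_le0//=.
  by rewrite -oppr_le0 -dualN f_le0// -scaleN1r; exact: DZ.
have := ann _ fD; rewrite fh hz => dz.
have [_ [d Dd <-]] : exists2 y, [set `|z - d| | d in D] y & y < e.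
  by apply: inf_lt; [exists `|z - 0|, 0|rewrite -/(dist z) dz].
by exists d.
Qed.

End annihilator.

Section rational_span.
Context {R : realType} {V : normedModType R} (u : nat -> V).

Definition rat_comb (q : seq (rat * nat)) : V :=
  \sum_(c <- q) ratr c.1 *: u c.2.

(** The closed linear span of [u]: stability under real scalars follows from the
    density of the rationals. *)
Definition rat_closure : set V :=
  [set z | forall e, 0 < e -> exists q, `|z - rat_comb q| < e].

Lemma rat_closure0 : rat_closure 0.
Proof.
by move=> e e0; exists [::]; rewrite /rat_comb big_nil subrr normr0.
Qed.

Lemma rat_closureD x y : rat_closure x -> rat_closure y -> rat_closure (x + y).
Proof.
move=> xu yu e e0.
have [p xp] := xu _ (divr_gt0 e0 (ltr0n _ 2)).
have [q yq] := yu _ (divr_gt0 e0 (ltr0n _ 2)).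
exists (p ++ q); rewrite /rat_comb big_cat /= opprD addrACA.
by rewrite (le_lt_trans (ler_normD _ _))// [ltRHS]splitr ltrD.
Qed.

Lemma rat_closureZ a x : rat_closure x -> rat_closure (a *: x).
Proof.
move=> xu e e0.
have a1 : 0 < `|a| + 1 by rewrite ltr_wpDl.
have [p xp] := xu _ (divr_gt0 (divr_gt0 e0 (ltr0n _ 2)) a1).
set y := rat_comb p in xp.
have y1 : 0 < `|y| + 1 by rewrite ltr_wpDl.
have d0 : 0 < e / 2 / (`|y| + 1) by rewrite !divr_gt0.
have /rat_in_itvoo[r] : a < a + e / 2 / (`|y| + 1) by rewrite ltrDl.
rewrite in_itv/= => /andP[ar ra].
have {ar ra} ar : `|a - ratr r| < e / 2 / (`|y| + 1).
  by rewrite distrC gtr0_norm ?subr_gt0// ltrBlDl.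
exists [seq (r * c.1, c.2) | c <- p].
have -> : rat_comb [seq (r * c.1, c.2) | c <- p] = ratr r *: y.
  rewrite /rat_comb big_map scaler_sumr; apply: eq_bigr => c _.
  by rewrite /= rmorphM scalerA.
have -> : a *: x - ratr r *: y = a *: (x - y) + (a - ratr r) *: y.
  by rewrite scalerBr scalerBl addrA subrK.
rewrite (le_lt_trans (ler_normD _ _))// [ltRHS]splitr !normrZ.
apply: ltr_leD.
  apply: le_lt_trans (_ : _ <= (`|a| + 1) * `|x - y|) _.
    by rewrite ler_wpM2r// lerDl.
  by rewrite mulrC -ltr_pdivlMr.
apply: le_trans (_ : _ <= `|a - ratr r| * (`|y| + 1)) _.
  by rewrite ler_wpM2l// lerDl.
by rewrite -ler_pdivlMr// ltW.
Qed.

Lemma rat_closure_u n : rat_closure (u n).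
Proof.
move=> e e0; exists [:: (1, n)].
by rewrite /rat_comb big_seq1 /= rmorph1 scale1r subrr normr0.
Qed.

Lemma rat_comb_dense z :
  (forall f : dual V, (forall n, f (u n) = 0) -> f z = 0) ->
  forall e, 0 < e -> exists q, `|z - rat_comb q| < e.
Proof.
move=> ann e e0.
have [|d du zd] := annihilator_closure rat_closure0 rat_closureD rat_closureZ
  (z := z) _ (divr_gt0 e0 (ltr0n _ 2)).
  by move=> f fD; apply: ann => n; apply: fD; exact: rat_closure_u.
have [q dq] := du _ (divr_gt0 e0 (ltr0n _ 2)).
exists q; rewrite -(subrK d z) -addrA (le_lt_trans (ler_normD _ _))//.
by rewrite [ltRHS]splitr ltrD.
Qed.

(** Norming functionals for a countable dense subset of the span of [u], listed
    along [nat]; indices that encode no combination get the zero vector. *)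
Definition comb_functional (j : nat) : dual V :=
  projT1 (cid2 (norming_functional (rat_comb (odflt [::] (unpickle j))))).

(** The hypothesis places [z] in the closed span of [u], so that some combination
    [y] is within [e / 2] of [z].  The functional that norms [y] vanishes at [z],
    whence [`|y| <= `|z - y|] and [`|z| <= e]. *)
Lemma comb_functional_separates z :
  (forall f : dual V, (forall n, f (u n) = 0) -> f z = 0) ->
  (forall j, comb_functional j z = 0) -> z = 0.
Proof.
move=> ann fz; apply/eqP; rewrite -normr_le0; apply/ler_addgt0Pl => e e0.
rewrite addr0; have [q zq] := rat_comb_dense ann (divr_gt0 e0 (ltr0n _ 2)).
set y := rat_comb q in zq.
have [f f1 [fy fz0]] : exists2 f : dual V, `|f| <= 1 & f y = `|y| /\ f z = 0.
  have := fz (pickle q); rewrite /comb_functional pickleK /=.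
  by case: cid2 => f /= f1 fy f0; exists f.
have yz : `|y| <= `|z - y|.
  have -> : `|y| = f (y - z) by rewrite dualB fz0 subr0 fy.
  rewrite distrC (le_trans (ler_norm _))// (le_trans (dual_le _ _))//.
  by rewrite ler_piMl.
rewrite -(subrK y z) (le_trans (ler_normD _ _))// [leRHS]splitr.
by apply: lerD; rewrite ltW// (le_lt_trans yz).
Qed.

End rational_span.

Section weak_compactness.
Context {R : realType} {V : normedModType R}.

Lemma ultra_cvg_bounded (T : Type) (U : set_system T) (a : T -> R) M :
  UltraFilter U -> (\forall t \near U, `|a t| <= M) ->
  exists l : R, a @ U --> l.
Proof.
move=> UU aM.
have [|l [_ al]] := @segment_compact R (- M) M (a @ U) _.
  by apply: filterS aM => t /=; rewrite in_itv/= ler_norml.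
exists l => W lW; have [//|UW] := in_ultra_setVsetC (a @^-1` W) UU.
by have [? []] := al (~` W) W UW lW.
Qed.

(** Along an ultrafilter all the bounded scalar sequences [f (u n)] converge.
    Their limits form a bounded linear functional of [f], which reflexivity
    represents by a point. *)
Lemma ultra_weak_limit (U : set_system nat) (u : nat -> V) M :
  reflexive_space V -> UltraFilter U -> (\forall n \near U, `|u n| <= M) ->
  exists x, forall f : dual V, f (u n) @[n --> U] --> f x.
Proof.
move=> reflV UU uM.
have fuM (f : dual V) : \forall n \near U, `|f (u n)| <= `|f| * M.
  by apply: filterS uM => n un; rewrite (le_trans (dual_le _ _))// ler_wpM2l.
have /choice[h hE] (f : dual V) : exists l : R, f (u n) @[n --> U] --> l.
  exact: ultra_cvg_bounded (fuM f).
have lin : linear (h : dual V -> R^o).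
  move=> a f g; apply: (norm_cvg_unique (hE (a *: f + g))).
  by apply: cvgD; [apply: cvgZl_tmp|]; exact: hE.
have hM (f : dual V) : `|h f| <= M * `|f|.
  rewrite mulrC; apply: (cvgr_to_le (f := fun n => `|f (u n)|) (F := U)) => //.
  by apply: cvg_norm; exact: hE.
have [phi phiE] := dual_of_bounded lin hM.
have [x xE] := reflV phi.
by exists x => f; rewrite -xE phiE.
Qed.

(** Fix a weak limit [x] of [u] along an ultrafilter finer than the filter at
    infinity.  As every neighbourhood of the limit is met infinitely often, one
    can select indices [s k] along which the countably many functionals
    [comb_functional u j] converge to their values at [x].  Every weak limit of
    [u \o s] along any other ultrafilter then has the same values, and both
    points lie in the closed span of [u], on which these functionals separate
    points; so the two limits coincide.  Hence no functional can stay away from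
    its value at [x] along [u \o s].  Only [k <= s k] is recorded about the
    subsequence: it makes [s] tend to infinity and is stable under
    composition. *)
Theorem weakly_cvg_subseq (u : nat -> V) M :
  reflexive_space V -> (\forall n \near \oo, `|u n| <= M) ->
  exists (s : nat -> nat) (x : V),
    (forall k, (k <= s k)%N) /\ weakly_cvg (u \o s) x.
Proof.
move=> reflV uM.
have [U [UU ooU]] := ultraFilterLemma eventually_filter.
have [x xE] := ultra_weak_limit reflV UU (ooU _ uM).
pose fj := comb_functional u.
have /choice[s sE] (k : nat) : exists n : nat, (k <= n)%N /\
    forall j : 'I_k, `|fj j x - fj j (u n)| < k.+1%:R^-1.
  apply: (@filter_ex _ U); apply: filterI; first by apply: ooU; exists k.
  apply: filter_forall => j; have /cvgrPdist_lt := xE (fj j); apply.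
  by rewrite invr_gt0.
have ks k : (k <= s k)%N by case: (sE k).
exists s, x; split => // f.
apply/cvgrPdist_lt => e e0; apply: contrapT => far.
pose A := [set k | e <= `|f x - f (u (s k))|].
(* If [f] stays away from [f x] on an infinite set [A], an ultrafilter living on
   [A] produces a second weak limit. *)
have WF : ProperFilter (within A \oo).
  apply: Build_ProperFilter_ex => P [N _ NP].
  apply: contrapT => nP; apply: far; exists N => // k /= Nk.
  by rewrite ltNge; apply/negP => Ak; apply: nP; exists k; exact: NP.
have [W [UW AW]] := ultraFilterLemma WF.
have ooW : \oo `<=` W by move=> P ooP; apply: AW; apply: filterS ooP.
have usM : \forall k \near W, `|(u \o s) k| <= M.
  apply: ooW; have [N _ NM] := uM; exists N => // k /= Nk.
  by apply: NM => /=; exact: leq_trans (ks k).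
have [y yE] := ultra_weak_limit reflV UW usM.
have xy : x - y = 0.
  apply: (comb_functional_separates (u := u)) => [g gu|j]; rewrite dualB.
    have gx : g x = 0.
      apply: (norm_cvg_unique (xE g)).
      by rewrite /= (_ : (fun n => g (u n)) = cst 0); [exact: cvg_cst|apply/funext].
    have gy : g y = 0.
      apply: (norm_cvg_unique (yE g)).
      by rewrite /= (_ : (fun n => g (u (s n))) = cst 0);
        [exact: cvg_cst|apply/funext => n; exact: gu].
    by rewrite gx gy subrr.
  apply/eqP; rewrite subr_eq0; apply/eqP/esym.
  apply: (norm_cvg_unique (yE (fj j))); apply: (cvg_trans (cvg_app _ ooW)).
  apply/cvgrPdist_lt => r r0; near=> k.
  have jk : (j < k)%N by near: k; exists j.+1.
  apply: lt_trans ((sE k).2 (Ordinal jk)) _.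
  by near: k; exact: near_infty_natSinv_lt (PosNum r0).
have {}xy : x = y by apply/eqP; rewrite -subr_eq0 xy.
have WA : W A by apply: AW; exact: withinT.
have : W [set k | `|f x - f (u (s k))| < e].
  by rewrite xy; have /cvgrPdist_lt := yE f; apply.
move=> /(filterI WA) /filter_ex[k [/= h1 h2]].
by move: h1; rewrite /A /= leNgt h2.
Unshelve. all: by end_near. Qed.

End weak_compactness.

(** * Completely continuous identities and their adjoints *)

Lemma reindex_cvg (s : nat -> nat) : (forall k, (k <= s k)%N) -> s @ \oo --> \oo.
Proof.
move=> ks P [N _ NP]; exists N => // k /= Nk.
by apply: NP => /=; exact: leq_trans (ks k).
Qed.

Lemma cvg_weakly_cvg (R : realType) (V : normedModType R) (u : nat -> V) (x : V) :
  u @ \oo --> x -> weakly_cvg u x.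
Proof. by move=> ux f; apply: continuous_cvg ux; exact: dual_continuous. Qed.

(** Norm convergence of the functionals lets weak convergence of bounded arguments
    pass through the duality pairing. *)
Lemma cvg_dual_pairing (R : realType) (V : normedModType R)
    (f_ : nat -> dual V) (f : dual V) (u : nat -> V) (x : V) M :
  f_ @ \oo --> f -> weakly_cvg u x -> (\forall k \near \oo, `|u k| <= M) ->
  f_ k (u k) @[k --> \oo] --> f x.
Proof.
move=> ff ux uM; apply/cvgrPdist_le => e e0.
have M1 : 0 < `|M| + 1 by rewrite ltr_wpDl.
have /cvgrPdist_le/(_ _ (divr_gt0 (divr_gt0 e0 (ltr0n _ 2)) M1)) ffe := ff.
have /cvgrPdist_le/(_ _ (divr_gt0 e0 (ltr0n _ 2))) uxe := ux f.
near=> k.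
have -> : f x - f_ k (u k) = (f x - f (u k)) + (f - f_ k) (u k).
  by rewrite [(f - f_ k) _]/(f (u k) - f_ k (u k)) addrA subrK.
rewrite (le_trans (ler_normD _ _))// [leRHS]splitr lerD//.
  by near: k; exact: uxe.
rewrite (le_trans (dual_le _ _))//.
apply: (@le_trans _ _ (`|f - f_ k| * (`|M| + 1))).
  rewrite ler_wpM2l//; apply: (@le_trans _ _ M).
    by near: k; exact: uM.
  by rewrite (le_trans (ler_norm _))// lerDl.
by rewrite -ler_pdivlMr//; near: k; exact: ffe.
Unshelve. all: by end_near. Qed.

Section compact_embedding.
Context {R : realType} {X : normedModType R} (N : norm_on X).
Hypothesis Ncc : completely_continuous (idfun : X -> renormed N).

Lemma weakly_cvg_norm_on (u : nat -> X) (x : X) : weakly_cvg u x ->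
  N (u k - x) @[k --> \oo] --> (0 : R).
Proof.
move=> /Ncc ux; apply/cvgrPdist_le => e e0.
have /cvgrPdist_le/(_ _ e0) uxe := ux.
near=> k; rewrite sub0r normrN ger0_norm; last exact: (@normr_ge0 _ (renormed N)).
rewrite -[N _]/(`|(u k : renormed N) - x|) distrC.
by near: k; exact: uxe.
Unshelve. all: by end_near. Qed.

(** The identity to [(X, N)] is sequentially continuous at 0, so [g] is bounded on
    some ball of [X]: otherwise there would be [x n] tending to 0 in [X] with
    [`|g (x n)| > 1]. *)
Lemma dual_norm_on_extend (g : dual (renormed N)) :
  exists f : dual X, forall z, f z = g z.
Proof.
have lin : linear ((fun z : X => g z) : X -> R^o).
  by move=> a x y; exact: (dual_linear g a x y).
suff [n gn] : exists n : nat, forall x : X, `|x| <= n.+1%:R^-1 -> `|g x| <= 1.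
  apply: (dual_of_bounded (M := n.+1%:R)) lin _ => x.
  have [->|x0] := eqVneq x 0; first by rewrite (dual0 g) !normr0 mulr0.
  have nx : 0 < (n.+1%:R * `|x|)^-1 by rewrite invr_gt0 mulr_gt0 ?normr_gt0.
  have := gn ((n.+1%:R * `|x|)^-1 *: x); rewrite normrZ (gtr0_norm nx).
  rewrite {1}invfM -mulrA mulVf ?normr_eq0// mulr1 => /(_ (lexx _)).
  rewrite (dualZ g) normrM (gtr0_norm nx).
  by rewrite ler_pdivrMl ?mulr1// -invr_gt0.
apply: contrapT => /forallNP H.
have /choice[x xP] n : exists x : X, `|x| <= n.+1%:R^-1 /\ 1 < `|g x|.
  have /existsNP[x /not_implyP[x1 /negP]] := H n.
  by rewrite -ltNge; exists x.
have x0 : x @ \oo --> (0 : X).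
  apply/cvgrPdist_le => e e0; near=> n; rewrite sub0r normrN.
  apply: (le_trans (xP n).1); apply/ltW.
  by near: n; exact: near_infty_natSinv_lt (PosNum e0).
have /cvgrPdist_lt/(_ 1 ltr01) := @dual_continuous _ _ g 0 .
move=> g0; have /Ncc/cvg_app/(_ _ g0)/= := cvg_weakly_cvg x0.
rewrite /nbhs/= => -[n _ /(_ n (leqnn n))/=].
by rewrite (dual0 g) sub0r normrN ltNge ltW// (xP n).2.
Unshelve. all: by end_near. Qed.

(** Compactness of the adjoint.  If [f_] did not converge in norm, there would be
    unit vectors [z k] at which [f - f_ k] stays above some [e > 0]; a subsequence
    converges weakly in [X] to some [y], hence for [N].  Split
    [(g - g_ k) (z k)] into [(g - g_ k) (z k - y)], small because the [g_ k] are
    bounded on [(X, N)], and [(g - g_ k) y], small by weak convergence tested on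
    the evaluation at [y]. *)
Lemma weakly_cvg_restrict (f_ : nat -> dual X) (f : dual X)
    (g_ : nat -> dual (renormed N)) (g : dual (renormed N)) M :
  reflexive_space X -> (forall k z, f_ k z = g_ k z) -> (forall z, f z = g z) ->
  (forall k, `|g_ k| <= M) -> weakly_cvg g_ g -> f_ @ \oo --> f.
Proof.
move=> reflX fg_ fg gM gg; apply/cvgrPdist_le => e e0; apply: contrapT => far.
have /choice[t tP] n : exists kz : nat * X,
    [/\ (n <= kz.1)%N, `|kz.2| <= 1 & e < (f - f_ kz.1) kz.2].
  apply: contrapT => /forallNP H; apply: far; exists n => // k /= nk.
  apply: dual_norm_le => z z1; rewrite leNgt; apply/negP => ez.
  by apply: (H (k, z)).
pose z n := (t n).2.
have z1 : \forall n \near \oo, `|z n| <= 1 by apply: nearW => n; case: (tP n).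
have [s [y [ks zy]]] := weakly_cvg_subseq reflX z1.
pose r k := (t (s k)).1.
have kr k : (k <= r k)%N by apply: leq_trans (ks k) _; case: (tP (s k)).
have [ey _ eyE] := dual_eval (y : renormed N).
have gy : g_ (r k) y @[k --> \oo] --> g y.
  have : g_ k y @[k --> \oo] --> g y.
    rewrite -eyE (_ : (fun k => _) = ey \o g_); first exact: gg.
    by apply/funext => k; rewrite /= eyE.
  exact: cvg_comp (reindex_cvg kr).
have gz : (`|g| + M) * N (z (s k) - y) @[k --> \oo] --> (0 : R).
  by rewrite -(mulr0 (`|g| + M)); apply: cvgMr; exact: weakly_cvg_norm_on.
have tot : (`|g| + M) * N (z (s k) - y) + (g y - g_ (r k) y) @[k --> \oo] --> (0 : R).
  have cvg_sum := cvgD gz (cvgB (cvg_cst (g y)) gy).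
  by rewrite subrr addr0 in cvg_sum; apply: cvg_sum.
have /cvgr_lt/(_ _ e0)[n _ /(_ n (leqnn n))/=] := tot.
apply/negP; rewrite -leNgt ltW//.
have [_ _ ez] := tP (s n); apply: (lt_le_trans ez).
rewrite -/(r n) -/(z (s n)); set w := z (s n) - y.
have gE (h : dual (renormed N)) : h (z (s n)) = h w + h y :> R.
  by rewrite -(dualD h) /w subrK.
have -> : (f - f_ (r n)) (z (s n)) = (g - g_ (r n)) w + (g y - g_ (r n) y) :> R.
  change (f (z (s n)) - f_ (r n) (z (s n)) =
    (g w - g_ (r n) w) + (g y - g_ (r n) y) :> R).
  by rewrite fg fg_ !gE; lra.
rewrite lerD// (le_trans (ler_norm _))//.
apply: (le_trans (dual_le (g - g_ (r n)) (w : renormed N))).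
apply: ler_wpM2r; first exact: (@normr_ge0 _ (renormed N)).
by rewrite (le_trans (ler_normB _ _))// lerD.
Qed.

End compact_embedding.

(** * Penalized energies with varying loads *)

Lemma limn_einf_le (R : realType) (u : nat -> \bar R) (l : \bar R) :
  (\forall k \near \oo, (u k <= l)%E) -> (limn_einf u <= l)%E.
Proof.
move=> [n _ ul]; rewrite limn_einf_lim; apply: lime_le; first exact: is_cvg_einfs.
exists n => // k /= nk; apply: ge_ereal_inf; exists (u k); first by exists k => /=.
exact: (ul k nk).
Qed.

Section energies.
Context {R : realType} {X B : normedModType R} (gamma : {linear X -> B}).
Variables (E : X -> \bar R) (p : R).
Hypothesis EN : forall x, E x != -oo%E.
Variables (A : nat -> set X) (lambda : nat -> R).

Let F f n := penalized_energy gamma E p (lambda n) (A n) f.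

Lemma penalized_energy_le n f x r : (F f n x <= r%:E)%E ->
  A n x /\ exists2 e, E x = e%:E & e + lambda n * `|gamma x| `^ p - f x <= r.
Proof.
rewrite /F /penalized_energy; case: ifPn => [/set_mem Ax|_]; last by [].
case: (E x) (EN x) => [e| |//] _ //=.
rewrite -[leLHS]/((e + lambda n * `|gamma x| `^ p - f x)%:E) lee_fin => er.
by split => //; exists e.
Qed.

Lemma penalized_energyE n f x e : A n x -> E x = e%:E ->
  F f n x = (e + lambda n * `|gamma x| `^ p - f x)%:E.
Proof. by move=> /mem_set Ax Ee; rewrite /F /penalized_energy Ax Ee. Qed.

(** The upper bound of Gamma-convergence: compare [x n] with a recovery sequence
    [u] for [z].  Its energies tend to [E z] by continuity of [E], its penalties
    to 0, and [f_ n (u n)] to [f z]. *)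
Lemma quasi_minimizers_asymptotic_le (delta : nat -> R)
    (f_ : nat -> dual X) (f : dual X) (x : nat -> X) (z : X) (e : R) :
  (exists u : nat -> X, [/\ forall n, A n (u n), u @ \oo --> z &
     lambda n * `|gamma (u n)| `^ p @[n --> \oo] --> (0 : R)]) ->
  {for z, continuous E} -> E z = e%:E ->
  delta @ \oo --> (0 : R) -> f_ @ \oo --> f ->
  (forall n, quasi_minimizers (F (f_ n) n) (delta n) (x n)) ->
  forall eta, 0 < eta ->
    \forall n \near \oo, (F (f_ n) n (x n) <= (e - f z + eta)%:E)%E.
Proof.
move=> [u [Au uz pu]] cE Ez d0 ff qx eta eta0.
have eta2 : 0 < eta / 2 by rewrite divr_gt0.
have Eu : \forall n \near \oo, (E (u n) < (e + eta / 2)%:E)%E.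
  have Euz : E (u n) @[n --> \oo] --> E z by exact: continuous_cvg.
  rewrite Ez in Euz; apply: (Euz [set v | (v < (e + eta / 2)%:E)%E]).
  by apply: open_ereal_lt'; rewrite lte_fin ltrDl.
have uM : \forall n \near \oo, `|u n| <= `|z| + 1.
  by apply: (cvgr_norm_le z) => //; rewrite ltrDl.
have fu := cvg_dual_pairing ff (cvg_weakly_cvg uz) uM.
have lim : lambda n * `|gamma (u n)| `^ p - f_ n (u n) + delta n
    @[n --> \oo] --> 0 - f z + 0.
  by apply: cvgD => //; apply: cvgB.
have /cvgr_le/(_ (- f z + eta / 2)) := lim.
rewrite sub0r addr0 ltrDl => /(_ eta2) lim_le.
near=> n.
have Eun : (E (u n) < (e + eta / 2)%:E)%E by near: n.
have len : lambda n * `|gamma (u n)| `^ p - f_ n (u n) + delta n <=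
  - f z + eta / 2 by near: n.
apply: (le_trans (qx n)).
have [b Eb] : exists b, E (u n) = b%:E.
  by case: (E (u n)) (EN (u n)) Eun => [b| |] // _ _; exists b.
rewrite Eb lte_fin in Eun.
have inf_le : (ereal_inf (range (F (f_ n) n)) <= F (f_ n) n (u n))%E.
  by apply: ereal_inf_lbound; exists (u n).
apply: (le_trans (leeD2r _ inf_le)).
rewrite (penalized_energyE _ (Au n) Eb) -EFinD lee_fin.
by lra.
Unshelve. all: by end_near. Qed.

(** Put [y n = x n / (1 + `|f_ n - f| * `|x n|)].  For a functional [h], either
    [x n] lies in the sublevel set at [r] of the energy with load [f + h], which
    is bounded by coercivity, or comparison with the load [f_ n] gives
    [h (x n) < (f_ n - f) (x n)], hence [h (y n) <= 1].  So [y] is weakly bounded,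
    hence bounded by some [M], that is
    [`|x n| <= M * (1 + `|f_ n - f| * `|x n|)]; since [`|f_ n - f|] tends to 0 the
    last term is absorbed on the left. *)
Lemma energy_sublevel_bounded (f_ : nat -> dual X) (f : dual X)
    (x : nat -> X) (r : R) :
  (forall h : dual X, equi_coercive (F h)) ->
  f_ @ \oo --> f -> (\forall n \near \oo, (F (f_ n) n (x n) <= r%:E)%E) ->
  exists M, \forall n \near \oo, `|x n| <= M.
Proof.
move=> coer ff [K _ Fx].
(* The energy bound holds from [K] on, and uniform boundedness needs all indices:
   hence the shift. *)
pose eps k := `|f_ (K + k)%N - f|.
pose xK k := x (K + k)%N.
pose y k := (1 + eps k * `|xK k|)^-1 *: xK k.
have c1 k : 1 <= 1 + eps k * `|xK k| by rewrite lerDl mulr_ge0 ?normr_ge0.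
have c0 k : 0 < 1 + eps k * `|xK k| by apply: lt_le_trans (c1 k).
have one_sided (h : dual X) : exists M, forall k, h (y k) <= M.
  have /pinfty_ex_gt0[C _ hC] := coer (f + h) r.
  exists (Num.max 1 (`|h| * C)) => k; rewrite le_max.
  have [Axk [e Ee er]] := penalized_energy_le (Fx (K + k)%N (leq_addr _ _)).
  have [hle|hgt] := leP (F (f + h) (K + k)%N (xK k)) r%:E; apply/orP.
    right; apply: (le_trans (ler_norm _)); apply: (le_trans (dual_le _ _)).
    rewrite ler_wpM2l//; apply: (@le_trans _ _ `|xK k|); last first.
      by apply: hC; exists (K + k)%N.
    rewrite normrZ ler_piMl// gtr0_norm ?invr_gt0//.
    by rewrite invf_le1.
  left; rewrite dualZ ler_pdivrMl// mulr1.
  move: hgt; rewrite (penalized_energyE _ Axk Ee) lte_fin.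
  rewrite dual_addE => hgt.
  have := le_trans (ler_norm _) (dual_le (f_ (K + k)%N - f) (xK k)).
  rewrite dual_subE -/(eps k).
  by rewrite /xK in er hgt *; lra.
have [M yM] : exists M, forall k, `|y k| <= M.
  apply: weakly_bounded_bounded => h.
  have [M1 hM1] := one_sided h; have [M2 hM2] := one_sided (- h).
  exists (Num.max M1 M2) => k; rewrite ler_norml lerNl !le_max.
  by rewrite hM1 /= andbT -[- h (y k)]/((- h) (y k)) hM2 orbT.
have M0 : 0 <= M by apply: le_trans (yM 0%N).
exists (2 * M).
have M1 : 0 < M + 1 by rewrite ltr_wpDl.
have /cvgrPdist_le/(_ _ (divr_gt0 (divr_gt0 ltr01 (ltr0n _ 2)) M1)) ffe := ff.
near=> n.
have Kn : (K <= n)%N by near: n; exists K.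
have fne : `|f - f_ n| <= 1 / 2 / (M + 1) by near: n; exact: ffe.
have := yM (n - K)%N; rewrite /y /xK /eps subnKC// normrZ.
rewrite gtr0_norm ?invr_gt0; last first.
  by have := c0 (n - K)%N; rewrite /eps /xK subnKC.
rewrite ler_pdivrMl; last by have := c0 (n - K)%N; rewrite /eps /xK subnKC.
move=> xnM; move: fne; rewrite distrC ler_pdivlMr// => fne.
have : `|f_ n - f| * (M + 1) * `|x n| <= 1 / 2 * `|x n| by rewrite ler_wpM2r.
have : 0 <= `|f_ n - f| * `|x n| by rewrite mulr_ge0.
by move: xnM; set a := `|x n|; set b := `|f_ n - f|; lra.
Unshelve. all: by end_near. Qed.

(** The lower bound of Gamma-convergence.  The energies stay bounded, which bounds
    [lambda n * `|gamma (x n)| `^ p], as [E] is bounded below and [f_ n (x n)]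
    converges.  Since [lambda] tends to infinity, [gamma xlim] cannot be nonzero:
    a functional norming it would keep [`|gamma (x n)|] away from 0.  Minimality
    follows from weak lower semicontinuity of [E] after dropping the nonnegative
    penalty. *)
Lemma weak_limit_minimizer (f_ : nat -> dual X) (f : dual X)
    (x : nat -> X) (xlim z0 : X) (c M : R) :
  continuous gamma -> 0 <= p -> lambda @ \oo --> +oo ->
  (forall x, (c%:E <= E x)%E) -> weakly_lower_semicontinuous E ->
  f_ @ \oo --> f -> weakly_cvg x xlim -> (\forall n \near \oo, `|x n| <= M) ->
  gamma z0 = 0 -> E z0 != +oo%E ->
  (forall z e, gamma z = 0 -> E z = e%:E -> forall eta, 0 < eta ->
    \forall n \near \oo, (F (f_ n) n (x n) <= (e - f z + eta)%:E)%E) ->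
  minimizer (limit_energy gamma E f) xlim.
Proof.
move=> cgamma p0 ly Ec lsc ff xx xM gz0 Ez0 asym.
have fx := cvg_dual_pairing ff xx xM.
have lambda0 : \forall n \near \oo, 0 <= lambda n by have /cvgryPge := ly; apply.
have gx0 : gamma xlim = 0.
  apply/eqP; apply: contrapT => /negP gx0.
  have [e0 Ee0] : exists e, E z0 = e%:E.
    by case: (E z0) (EN z0) Ez0 => [e| |] // _ _; exists e.
  have Fle := asym _ _ gz0 Ee0 1 ltr01; set r := e0 - f z0 + 1 in Fle.
  have [h h1 hx] := norming_functional (gamma xlim).
  have hg_lin : linear ((fun z => h (gamma z)) : X -> R^o).
    by move=> a u v; rewrite linearP dual_linear.
  have hg_cont : continuous ((fun z => h (gamma z)) : X -> R^o).
    by move=> z; apply: continuous_comp; [exact: cgamma|exact: dual_continuous].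
  have hgx := xx (Dual (asboolT (conj hg_lin hg_cont))); rewrite /= hx in hgx.
  have w0 : 0 < `|gamma xlim| / 2 by rewrite divr_gt0 ?normr_gt0.
  set w := `|gamma xlim| / 2 in w0.
  have w_lt : w < `|gamma xlim| by rewrite /w ltr_pdivrMr ?ltr_pMr ?normr_gt0 ?ltr1n.
  have hgw : \forall n \near \oo, w <= h (gamma (x n)).
    exact: (cvgr_ge _ hgx _ w_lt).
  have fx1 : \forall n \near \oo, f_ n (x n) <= f xlim + 1.
    by apply: (cvgr_le _ fx); rewrite ltrDl.
  have wp : 0 < w `^ p by rewrite powR_gt0.
  have lbig : \forall n \near \oo, (r - c + f xlim + 1) / w `^ p < lambda n.
    by have /cvgryPgt := ly; apply.
  suff : \forall n \near \oo, False by move=> /filter_ex[].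
  near=> n.
  have Fn : (F (f_ n) n (x n) <= r%:E)%E by near: n.
  have [_ [e Ee er]] := penalized_energy_le Fn.
  have ce : c <= e by rewrite -lee_fin -Ee.
  have fn1 : f_ n (x n) <= f xlim + 1 by near: n.
  have l0 : 0 <= lambda n by near: n.
  have ln : (r - c + f xlim + 1) / w `^ p < lambda n by near: n.
  have wn : w <= `|gamma (x n)|.
    apply: (@le_trans _ _ (h (gamma (x n)))); first by near: n.
    rewrite (le_trans (ler_norm _))// (le_trans (dual_le _ _))//.
    by rewrite ler_piMl.
  have : lambda n * w `^ p <= lambda n * `|gamma (x n)| `^ p.
    apply: ler_wpM2l => //; apply: ge0_ler_powR => //; rewrite nnegrE ?normr_ge0//.
    exact: ltW.
  by move: ln; rewrite ltr_pdivrMr//; lra.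
move=> z; rewrite /limit_energy gx0 eqxx.
case: ifPn => [/eqP gz|_]; last exact: leey.
case Ez: (E z) => [e| |]; [|exact: leey|by have := EN z; rewrite Ez].
suff le_eta eta : 0 < eta -> (E xlim <= (e - f z + f xlim + eta)%:E)%E.
  have : (E xlim <= (e - f z + f xlim)%:E)%E.
    by apply/lee_addgt0Pr => eta eta0; rewrite -EFinD; exact: le_eta.
  case: (E xlim) (EN xlim) => [b| |] // _; rewrite -!EFinB !lee_fin; lra.
move=> eta0; apply: (le_trans (lsc _ _ xx)); apply: limn_einf_le.
have eta2 : 0 < eta / 2 by rewrite divr_gt0.
have Fle := asym _ _ gz Ez _ eta2.
have fxe : \forall n \near \oo, f_ n (x n) <= f xlim + eta / 2.
  by apply: (cvgr_le _ fx); rewrite ltrDl.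
near=> n.
have Fn : (F (f_ n) n (x n) <= (e - f z + eta / 2)%:E)%E by near: n.
have [_ [b Eb br]] := penalized_energy_le Fn.
have l0 : 0 <= lambda n by near: n.
have fn : f_ n (x n) <= f xlim + eta / 2 by near: n.
have : 0 <= lambda n * `|gamma (x n)| `^ p by rewrite mulr_ge0// powR_ge0.
by rewrite /= Eb lee_fin; lra.
Unshelve. all: by end_near. Qed.

End energies.

(** * Subsequences of quasi-minimizers and the uniform estimate *)

Section solution_map.
Context {R : realType} {X B : normedModType R} (gamma : {linear X -> B}).

Lemma null_restrict_norm_le (h : dual X) : `|null_restrict gamma h| <= `|h|.
Proof. by apply: dual_norm_le_bound => // x; exact: (dual_le h (null_val x)). Qed.

Lemma null_restrict_cvg (f_ : nat -> dual X) (f : dual X) : f_ @ \oo --> f ->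
  (fun n => null_restrict gamma (f_ n)) @ \oo --> null_restrict gamma f.
Proof.
move=> ff; apply/cvgrPdist_le => e e0.
have /cvgrPdist_le/(_ _ e0) ffe := ff.
near=> n; apply: (@le_trans _ _ `|f - f_ n|); last by near: n.
have -> : null_restrict gamma f - null_restrict gamma (f_ n) =
    null_restrict gamma (f - f_ n) by exact: val_inj.
exact: null_restrict_norm_le.
Unshelve. all: by end_near. Qed.

Lemma demi_continuous_null (S : dual (null_space gamma) -> null_space gamma)
    (f_ : nat -> dual X) (f : dual X) :
  demi_continuous S -> f_ @ \oo --> f ->
  weakly_cvg (fun n => null_val (S (null_restrict gamma (f_ n))))
    (null_val (S (null_restrict gamma f))).
Proof.
move=> dS ff h; exact: (dS _ _ (null_restrict_cvg ff) (null_restrict gamma h)).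
Qed.

End solution_map.

Section quasi_minimizers.
Context {R : realType} {X B : normedModType R} (gamma : {linear X -> B}).
Variables (E : X -> \bar R) (p : R) (N : norm_on X).
Variable S : dual (null_space gamma) -> null_space gamma.
Let xmin (f : dual X) := null_val (S (null_restrict gamma f)).
Hypotheses (reflX : reflexive_space X) (cgamma : continuous gamma).
Hypotheses (EN : forall x, E x != -oo%E) (p1 : 1 < p).
Hypothesis Ebnd : exists c : R, forall x, (c%:E <= E x)%E.
Hypotheses (Elsc : weakly_lower_semicontinuous E) (Econt : continuous E).
Hypothesis Ncc : completely_continuous (idfun : X -> renormed N).
Hypothesis xminP :
  forall f : dual X, unique (minimizer (limit_energy gamma E f)) (xmin f).
Hypothesis Sdemi : demi_continuous S.

Lemma norm_on0 : N 0 = 0.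
Proof. exact: (@normr0 _ (renormed N)). Qed.

(** Both [x n] and [xmin (f_ n)] converge weakly to [xmin f] along a subsequence,
    and complete continuity turns this into convergence for [N]. *)
Lemma quasi_minimizers_subseq (A : nat -> set X) (lambda delta : nat -> R)
    (f_ : nat -> dual X) (f : dual X) (x : nat -> X) :
  lambda @ \oo --> +oo -> delta @ \oo --> (0 : R) ->
  (forall x : X, gamma x = 0 -> exists u : nat -> X,
     [/\ forall n, A n (u n), u @ \oo --> x &
         lambda n * `|gamma (u n)| `^ p @[n --> \oo] --> (0 : R)]) ->
  (forall h : dual X,
     equi_coercive (fun n => penalized_energy gamma E p (lambda n) (A n) h)) ->
  f_ @ \oo --> f ->
  (forall n, quasi_minimizers
     (penalized_energy gamma E p (lambda n) (A n) (f_ n)) (delta n) (x n)) ->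
  exists2 s : nat -> nat, forall k, (k <= s k)%N &
    N (x (s k) - xmin (f_ (s k))) @[k --> \oo] --> (0 : R).
Proof.
move=> ly d0 rec coer ff qx.
(* If [E] is infinite on the whole kernel, every point minimizes the limit energy
   and uniqueness leaves a single point in [X]. *)
have [[z0 gz0 Ez0]|Ey] :=
  pselect (exists2 z, gamma z = 0 & E z != +oo%E); last first.
  have Fy h z : limit_energy gamma E h z = +oo%E.
    rewrite /limit_energy; case: ifPn => // /eqP gz.
    suff -> : E z = +oo%E by [].
    by apply/eqP; apply: contrapT => /negP Ez; apply: Ey; exists z.
  have all_min h z : xmin h = z by apply: (xminP h).2 => t; rewrite !Fy.
  exists id => //; rewrite (_ : (fun k => _) = cst 0); first exact: cvg_cst.
  by apply/funext => k; rewrite /= (all_min _ (x k)) subrr norm_on0.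
have asym z e : gamma z = 0 -> E z = e%:E -> forall eta, 0 < eta ->
    \forall n \near \oo, (penalized_energy gamma E p (lambda n) (A n) (f_ n) (x n)
      <= (e - f z + eta)%:E)%E.
  move=> gz Ez.
  exact: (quasi_minimizers_asymptotic_le EN (rec z gz) (@Econt z) Ez d0 ff qx).
have [e0 Ee0] : exists e, E z0 = e%:E.
  by case: (E z0) (EN z0) Ez0 => [e| |] // _ _; exists e.
have [M xM] := energy_sublevel_bounded EN coer ff (asym _ _ gz0 Ee0 _ ltr01).
have [s [xl [ks xs]]] := weakly_cvg_subseq reflX xM.
have s_oo := reindex_cvg ks.
have fs : f_ \o s @ \oo --> f by exact: cvg_comp s_oo ff.
have [c Ec] := Ebnd.
have xl_min : minimizer (limit_energy gamma E f) xl.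
  apply: (@weak_limit_minimizer _ _ _ gamma E p EN (A \o s) (lambda \o s)
    (f_ \o s) f (x \o s) xl z0 c M) => //.
  - by rewrite ltW// (lt_trans ltr01).
  - exact: cvg_comp s_oo ly.
  - exact: s_oo _ xM.
  - by move=> z e gz Ez eta eta0; exact: s_oo _ (asym z e gz Ez eta eta0).
have xlE : xmin f = xl by exact: (xminP f).2.
have x1 := weakly_cvg_norm_on Ncc xs.
have x2 := weakly_cvg_norm_on Ncc (demi_continuous_null Sdemi fs).
exists s => //.
have x12 : N (x (s k) - xl) + N (xmin (f_ (s k)) - xmin f) @[k --> \oo] --> (0 : R).
  by have sum := cvgD x1 x2; rewrite addr0 in sum; exact: sum.
apply: (squeeze_cvgr _ (cvg_cst 0) x12).
apply: nearW => k; apply/andP; split; first exact: (@normr_ge0 _ (renormed N)).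
rewrite xlE.
have := @ler_normB R (renormed N) (x (s k) - xl) (xmin (f_ (s k)) - xl).
by rewrite opprB addrA subrK.
Unshelve. all: by end_near. Qed.

End quasi_minimizers.

Lemma sup_ge0_cvg0 (R : realType) (A : nat -> set (\bar R)) :
  (forall e : R, 0 < e -> exists n0, forall n, (n0 <= n)%N ->
     forall a, A n a -> (a <= e%:E)%E) ->
  sup_ge0 (A n) @[n --> \oo] --> (0 : \bar R)%E.
Proof.
move=> Ale.
have ge0 n : (0 <= sup_ge0 (A n))%E by apply: ereal_sup_ubound; left.
have le_e e : 0 < e -> \forall n \near \oo, (sup_ge0 (A n) <= e%:E)%E.
  move=> e0; have [n0 An0] := Ale e e0; exists n0 => // n /= nn0.
  apply: ge_ereal_sup => a [->|/(An0 n nn0)//].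
  by rewrite lee_fin ltW.
have fin : \forall n \near \oo, sup_ge0 (A n) \is a fin_num.
  near=> n; rewrite ge0_fin_numE//; apply: (@le_lt_trans _ _ 1%:E).
    by near: n; exact: le_e.
  exact: ltry.
apply/fine_cvgP; split => //; apply/cvgrPdist_le => e e0.
near=> n; rewrite sub0r normrN ger0_norm ?fine_ge0//.
rewrite -lee_fin fineK; first by near: n; exact: le_e.
by near: n.
Unshelve. all: by end_near. Qed.

Theorem theorem12 (R : realType) (X B : completeNormedModType R)
    (gamma : {linear X -> B})
    (d m : nat) (FX : function_space d m X)
    (rho : R -> R)
    (hs : nat -> seq nat) (Theta : forall n : nat, set (nn_param R d (hs n) m))
    (E : X -> \bar R) (lambda : nat -> R) (p : R)
    (N : norm_on X)
    (S : dual (null_space gamma) -> null_space gamma)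
    (delta : nat -> R) (rad : R) :
  let A := fun n => [set fclass FX (nn_fun rho theta) | theta in Theta n] in
  let F_ := fun f n => penalized_energy gamma E p (lambda n) (A n) f in
  let F := limit_energy gamma E in
  let xmin := fun f : dual X => null_val (S (null_restrict gamma f)) in
  reflexive_space X ->
  reflexive_space B ->
  continuous gamma ->
  (forall n (theta : nn_param R d (hs n) m),
     Theta n theta -> fdom FX (nn_fun rho theta)) ->
  (forall x, E x != -oo%E) ->
  lambda @ \oo --> +oo ->
  1 < p ->
  reflexive_space (dual (renormed N)) ->
  (forall x : X, gamma x = 0 ->
     exists u : nat -> X,
       [/\ forall n, A n (u n),
           u @ \oo --> x &
           lambda n * `|gamma (u n)| `^ p @[n --> \oo] --> (0 : R)]) ->
  (exists c : R, forall x, (c%:E <= E x)%E) ->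
  weakly_lower_semicontinuous E ->
  continuous E ->
  (forall f : dual X, equi_coercive (F_ f)) ->
  completely_continuous (idfun : X -> renormed N) ->
  (forall f : dual X, unique (minimizer (F f)) (xmin f)) ->
  demi_continuous S ->
  nonincreasing_seq delta ->
  delta @ \oo --> (0 : R) ->
  0 < rad ->
  sup_ge0 [set e | exists (f : dual X) (g : dual (renormed N)) (x : X),
             [/\ forall z : X, f z = g z,
                 `|g| <= rad,
                 quasi_minimizers (F_ f n) (delta n) x &
                 e = (N (x - xmin f))%:E]]
    @[n --> \oo] --> (0 : \bar R)%E.
Proof.
move=> A F_ F xmin reflX _ cgamma _ EN ly p1 reflD rec Ebnd lsc cE coer cc
  xminP dS _ d0 rad0.
apply: sup_ge0_cvg0 => e e0; apply: contrapT => /forallNP far.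
have /choice[w wP] n : exists w : nat * (dual X * dual (renormed N)) * X,
    [/\ (n <= w.1.1)%N, forall z : X, w.1.2.1 z = w.1.2.2 z, `|w.1.2.2| <= rad,
      quasi_minimizers (F_ w.1.2.1 w.1.1) (delta w.1.1) w.2 &
      e < N (w.2 - xmin w.1.2.1)].
  have /existsNP[k /not_implyP[nk]] := far n.
  move=> /existsNP[_ /not_implyP[[f [g [x [fg gr qx ->]]]] /negP]].
  by rewrite -ltNge lte_fin => ex; exists (k, (f, g), x); split.
have grad : \forall n \near \oo, `|(w n).1.2.2| <= rad.
  by apply: nearW => n; case: (wP n).
have [s [g [ks gg]]] := weakly_cvg_subseq reflD grad.
have [f fg] := dual_norm_on_extend cc g.
pose r k := (w (s k)).1.1.
have kr k : (k <= r k)%N by apply: leq_trans (ks k) _; case: (wP (s k)).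
have r_oo := reindex_cvg kr.
have ff : (fun k => (w (s k)).1.2.1) @ \oo --> f.
  apply: (weakly_cvg_restrict cc reflX (g_ := fun k => (w (s k)).1.2.2)
    (g := g) (M := rad)) => //.
    by move=> k z; case: (wP (s k)).
  by move=> k; case: (wP (s k)).
(* All assumptions on [A], [lambda] and [delta] survive reindexing by [r], so the
   statement on subsequences applies to the contradicting sequence. *)
have [||x gx|h|n|t _ tx] := quasi_minimizers_subseq reflX cgamma EN p1 Ebnd lsc cE cc
  xminP dS (A := A \o r) (lambda := lambda \o r) (delta := delta \o r)
  (x := fun k => (w (s k)).2) _ _ _ _ ff _.
- exact: cvg_comp r_oo ly.
- exact: cvg_comp r_oo d0.
- have [u [Au ux pu]] := rec x gx.
  exists (u \o r); split; first by move=> n; exact: Au.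
    exact: cvg_comp r_oo ux.
  exact: (cvg_comp _ _ r_oo pu).
- move=> c; have [M [Mreal hM]] := coer h c.
  by exists M; split => // b Mb x [n _ Fn]; apply: (hM b Mb); exists (r n).
- by case: (wP (s n)).
have /cvgr_lt/(_ _ e0)[n _ /(_ n (leqnn n))/=] := tx.
by case: (wP (s (t n))) => _ _ _ _ /lt_trans h /h; rewrite ltxx.
Qed.
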